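(* Let $\alpha$ be a Pisot number. Then the set \[ \mathcal{L}(\alpha)=\left\{\limsup_{n\to\infty}\|\xi\alpha^n\| \;:\; \xi\in\mathbb{R}\right\} \] is a closed subset of $[0,1/2]$.
   Context: For a real number $x$, $\|x\|$ denotes the distance from $x$ to the nearest integer. A Pisot number is a real algebraic integer $\alpha>1$ all of whose Galois conjugates other than $\alpha$ itself have absolute value less than $1$ (every rational integer $\geq 2$ is a Pisot number). *)

(* Defs.v *)
From HB Require Import structures.
From mathcomp Require Import all_boot all_order all_algebra.
From mathcomp Require Import complex.
From mathcomp Require Import all_classical all_reals all_analysis.

Set Implicit Arguments.
Unset Strict Implicit.
Unset Printing Implicit Defensive.

Import Order.TTheory GRing.Theory Num.Theory.
Import numFieldNormedType.Exports.

Local Open Scope classical_set_scope.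
Local Open Scope ring_scope.

(* ||x|| in the sense of Diophantine approximation. *)
Definition dist_int (R : realType) (x : R) : R :=
  inf [set `|x - m%:~R| | m in [set: int]].

(* An irreducible p over Q with root a is, up to a nonzero constant factor, the
   minimal polynomial of a over Q, so its choice does not matter. *)
Definition galois_conjugate (R : realType) (a : R) (z : R[i]) : Prop :=
  exists p : {poly rat},
    [/\ irreducible_poly p, root (map_poly ratr p) a
      & root (map_poly ratr p) z].

(* The norm of z : R[i] is itself an element of R[i], and x < y in R[i] forces
   y - x to be real; hence `|z| < 1 is the usual condition on the modulus. *)
Definition pisot (R : realType) (a : R) : Prop :=
  [/\ 1 < a,
      integralOver (intr : int -> R) a
    & forall z : R[i], galois_conjugate a z -> z != (a%:C)%C -> `|z| < 1].

Definition limsup_spectrum (R : realType) (a : R) : set R :=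
  [set limn_sup (fun n : nat => dist_int (xi * a ^+ n)) | xi in [set: R]].

(* Main.v *)
(** Let [P = (X - a) Q] be the minimal polynomial of [a], and write [||x||]
    for [dist_int x]. The sequences [xi a^n] are characterized up to [o(1)]
    modulo 1 by a shadowing property: if [||P(S) e|| --> 0], where [S] is the
    shift, then [||xi a^n - e n|| --> 0] for some [xi]. Indeed an integer
    sequence [u] can be subtracted so that [P(S) (e - u) --> 0]; since [a > 1],
    [Q(S) (e - u)] then follows a multiple of [a^n], and since the roots of [Q]
    lie in the open unit disc, so does [e - u].

    If [l] is a limit of limsups of sequences [xi_k a^n], compactness of the
    torus gives a point [c] of [(R/Z)^d], with [d] larger than the degree of
    [P], near which long excursions of these sequences start and end, with
    supremum close to [l]. Concatenating better and better excursions gives a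
    sequence [e] with [||P(S) e|| --> 0] and [limsup ||e n|| = l], and the [xi]
    that shadows it realizes [l]. *)
Require Import Defs.
From mathcomp Require Import all_boot all_order all_algebra fieldext complex.
From mathcomp Require polyorder qpoly.
From mathcomp Require Import all_classical all_reals all_analysis.
From mathcomp Require Import lra ring zify.

Set Implicit Arguments.
Unset Strict Implicit.
Unset Printing Implicit Defensive.

Import Order.TTheory GRing.Theory Num.Theory.
Import numFieldNormedType.Exports.

Local Open Scope classical_set_scope.
Local Open Scope ring_scope.

(** * Integral minimal polynomial of a Pisot number *)

(** Take [p] of least size among the nonzero polynomials vanishing at [z]. Its gcd with [p0]
    vanishes at [z] too, so minimality makes it associate to [p]. *)
Lemma exists_min_rat_poly (L : numFieldType) (z : L) (p0 : {poly rat}) :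
  p0 != 0 -> root (map_poly ratr p0) z ->
  exists p : {poly rat},
    [/\ irreducible_poly p, root (map_poly ratr p) z & p %| p0].
Proof.
move=> p0_neq0 p0z.
pose S n := `[< exists p : {poly rat},
   [/\ p != 0, root (map_poly ratr p) z & size p = n] >].
have Sex : exists n, S n by exists (size p0); apply/asboolP; exists p0.
case: (ex_minnP Sex) => m /asboolP[p [p_neq0 pz szp]] mmin.
have pmin q : root (map_poly ratr q) z -> q != 0 -> (size p <= size q)%N.
  by move=> qz q0; rewrite szp; apply: mmin; apply/asboolP; exists q.
exists p; split => //.
  exact/(subfx_irreducibleP pz p_neq0).
have gz : root (map_poly ratr (gcdp p p0)) z.
  by rewrite gcdp_map root_gcd pz p0z.
have /(pmin _ gz) szg : gcdp p p0 != 0 by rewrite gcdp_eq0 negb_and p_neq0.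
have /eqp_dvdl <- : gcdp p p0 %= p; last exact: dvdp_gcdr.
rewrite -dvdp_size_eqp ?dvdp_gcdl // eqn_leq szg andbT.
exact: dvdp_leq (dvdp_gcdl _ _).
Qed.

(** Gauss's lemma: up to a rational constant, [p] is an integer factor of [p0], whose leading
    coefficient divides 1 and is therefore 1 or -1. *)
Lemma monic_int_scale (p : {poly rat}) (p0 : {poly int}) :
  p0 \is monic -> p %| map_poly intr p0 ->
  exists2 P : {poly int}, P \is monic &
    exists2 c : rat, c != 0 & p = c *: map_poly intr P.
Proof.
move=> /monicP p0_monic /dvdpP_rat_int[p1 [c c_neq0 ->] [r p0E]].
have lc : lead_coef p1 * lead_coef r = 1 by rewrite -lead_coefM -p0E.
have [lcE|p1N1] := eqVneq (lead_coef p1) 1.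
  by exists p1; [apply/monicP | exists c].
have lcE : lead_coef p1 = -1.
  have := congr1 absz lc; rewrite abszM => /eqP; rewrite muln_eq1 => /andP[/eqP].
  by move: p1N1; case: (intP (lead_coef p1)) => [|[|n]|[|n]].
exists (- p1); first by rewrite monicE lead_coefN lcE opprK.
by exists (- c); rewrite ?oppr_eq0 // rmorphN scalerN scaleNr opprK.
Qed.

(** Separability in characteristic 0: the derivative is nonzero and of smaller size, hence coprime
    to [p]. *)
Lemma irreducible_deriv_root (L : numFieldType) (z : L) (p : {poly rat}) :
  irreducible_poly p -> root (map_poly ratr p) z ->
  ~~ root (map_poly ratr p)^`() z.
Proof.
move=> p_irr pz; apply/negP => p'z; have [sp _] := p_irr.
have p'0 : p^`() != 0.
  by rewrite -size_poly_gt0 polyorder.size_deriv -ltnS prednK // (ltn_trans _ sp).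
have : root (map_poly ratr (gcdp p p^`())) z.
  by rewrite gcdp_map root_gcd pz -deriv_map.
have /eqp_size : gcdp p p^`() %= 1.
  rewrite gcdp_eqp1 qpoly.irreducible_poly_coprime //.
  by rewrite gtNdvdp // lt_size_deriv // irredp_neq0.
rewrite size_poly1 => /eqP/size_poly1P[c c0 ->].
by rewrite map_polyC rootC fmorph_eq0 (negPf c0).
Qed.

Lemma pisot_poly (R : realType) (a : R) : pisot a ->
  exists (P : {poly int}) (Q : {poly R}),
    [/\ P \is monic, map_poly intr P = ('X - a%:P) * Q, ~~ root Q a
      & forall z : R[i], root (map_poly (real_complex R) Q) z -> `|z| < 1].
Proof.
move=> [a_gt1 [p0 p0_monic p0a] conj_lt1].
have int_rat (L : numFieldType) (p : {poly int}) :
    map_poly (ratr : rat -> L) (map_poly intr p) = map_poly intr p.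
  by rewrite -map_poly_comp; apply: eq_map_poly => n /=; rewrite ratr_int.
have [||p [p_irr pa pp0]] := @exists_min_rat_poly R a (map_poly intr p0).
- by rewrite -size_poly_gt0 size_rat_int_poly size_poly_gt0 monic_neq0.
- by rewrite int_rat.
have [P P_monic [c c_neq0 pE]] := monic_int_scale p0_monic pp0.
have ratPE (L : numFieldType) (z : L) :
    root (map_poly ratr p) z = root (map_poly intr P) z.
  by rewrite pE map_polyZ /= int_rat rootZ // fmorph_eq0.
move: (pa); rewrite ratPE => /factor_theorem[Q PE].
have Qa : ~~ root Q a.
  apply/negP => Qa; have /negP := irreducible_deriv_root p_irr pa; apply.
  rewrite pE map_polyZ /= int_rat PE derivZ rootZ ?fmorph_eq0 //.
  by rewrite derivM derivXsubC mulr1 rootE hornerD hornerM hornerXsubC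
    subrr mulr0 add0r.
exists P, Q; split => //; first by rewrite mulrC.
move=> z Qz; apply: conj_lt1.
  exists p; split => //; rewrite ratPE.
  have -> : map_poly intr P = map_poly (real_complex R) (map_poly intr P).
    rewrite -map_poly_comp; apply: eq_map_poly => n /=.
    by rewrite rmorph_int.
  by rewrite PE rmorphM rootM Qz.
(* Since [a] is a simple root of [P], a root of [Q] is a conjugate distinct from [a]. *)
apply: contraNneq Qa => zE.
by rewrite zE fmorph_root in Qz.
Qed.

(** * Distance to the nearest integer *)

Section DistInt.
Context {R : realType}.
Implicit Types (x y : R) (m : int).

Lemma has_lbound_dist x : has_lbound [set `|x - m%:~R| | m in [set: int]].
Proof. by exists 0 => _ [m _ <-]. Qed.

Lemma dist_int_le x m : dist_int x <= `|x - m%:~R|.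
Proof. by apply: ge_inf; [exact: has_lbound_dist | exists m]. Qed.

(** The integer part of [x + 1/2] is within [1/2] of [x], so every other integer is at distance at
    least [1/2]. *)
Lemma dist_int_attained x :
  exists2 m, dist_int x = `|x - m%:~R| & `|x - m%:~R| <= 1 / 2.
Proof.
pose m := Num.floor (x + 1 / 2).
have /andP[m_le m_gt] : m%:~R <= x + 1 / 2 < (m + 1)%:~R.
  by rewrite floor_le_tmp floorD1_gt.
rewrite rmorphD /= in m_gt.
have xm : `|x - m%:~R| <= 1 / 2 by rewrite ler_norml; apply/andP; split; lra.
exists m => //; apply/eqP; rewrite eq_le dist_int_le /=.
apply: lb_le_inf; first by exists `|x - m%:~R|, m.
move=> _ [n _ <-]; have [nm|mn|->] := ltgtP n m; last by [].
  have : (n + 1)%:~R <= m%:~R :> R by rewrite ler_int lezD1.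
  rewrite rmorphD /= => nm'; rewrite (le_trans xm) // ler_normr.
  by apply/orP; left; lra.
have : (m + 1)%:~R <= n%:~R :> R by rewrite ler_int lezD1.
rewrite rmorphD /= => mn'; rewrite ler_normr; apply/orP; right.
by rewrite ler_norml; apply/andP; split; lra.
Qed.

Lemma dist_int_ge0 x : 0 <= dist_int x.
Proof. by have [m ->] := dist_int_attained x. Qed.

Lemma dist_int_le_half x : dist_int x <= 1 / 2.
Proof. by have [m ->] := dist_int_attained x. Qed.

Lemma dist_int_le_norm x : dist_int x <= `|x|.
Proof. by have := dist_int_le x 0; rewrite subr0. Qed.

Lemma dist_intD x y : dist_int (x + y) <= dist_int x + dist_int y.
Proof.
have [m -> _] := dist_int_attained x; have [n -> _] := dist_int_attained y.
apply: le_trans (dist_int_le _ (m + n)) _.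
by rewrite rmorphD /= opprD addrACA ler_normD.
Qed.

Lemma dist_int_Mz m x : dist_int (m%:~R * x) <= `|m%:~R| * dist_int x.
Proof.
have [n -> _] := dist_int_attained x.
apply: le_trans (dist_int_le _ (m * n)) _.
by rewrite rmorphM /= -mulrBr normrM.
Qed.

Lemma dist_intN x : dist_int (- x) = dist_int x.
Proof.
suff le_N y : dist_int (- y) <= dist_int y.
  by apply/eqP; rewrite eq_le le_N -{1}(opprK x) le_N.
by have := dist_int_Mz (-1) y; rewrite rmorphN mulN1r normrN1 mul1r.
Qed.

Lemma dist_int_sum (I : Type) (r : seq I) (F : I -> R) :
  dist_int (\sum_(i <- r) F i) <= \sum_(i <- r) dist_int (F i).
Proof.
elim/big_ind2: _ => // [|x1 x2 y1 y2 le1 le2].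
  by rewrite (le_trans (dist_int_le_norm 0)) // normr0.
by rewrite (le_trans (dist_intD _ _)) // lerD.
Qed.

Lemma dist_int_intr m : dist_int (m%:~R : R) = 0.
Proof.
apply/eqP; rewrite eq_le dist_int_ge0 andbT.
by rewrite (le_trans (dist_int_le _ m)) // subrr normr0.
Qed.

Lemma dist_intDz x m : dist_int (x + m%:~R) = dist_int x.
Proof.
suff leD y n : dist_int (y + n%:~R) <= dist_int y.
  apply/eqP; rewrite eq_le leD -{1}(addrK m%:~R x) -rmorphN.
  by rewrite leD.
by rewrite (le_trans (dist_intD _ _)) // dist_int_intr addr0.
Qed.

Lemma dist_int_dist x y : `|dist_int x - dist_int y| <= dist_int (x - y).
Proof.
have := dist_intD (y - x) x; rewrite subrK => yx.
have := dist_intD (x - y) y; rewrite subrK => xy.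
rewrite -(opprB x y) dist_intN in yx.
by rewrite ler_norml; apply/andP; split; lra.
Qed.

End DistInt.

(** * Upper limits by epsilons, and the range of the spectrum *)

Section LimnSup.
Context {R : realType}.
Implicit Types (u : nat -> R) (l : R).

(** This form spares handling infima of suprema; it agrees with [limn_sup] on bounded sequences. *)
Definition is_limn_sup u l :=
  (forall e, 0 < e -> exists N, forall n, (N <= n)%N -> u n <= l + e) /\
  (forall e N, 0 < e -> exists2 n, (N <= n)%N & l - e <= u n).

Lemma is_limn_sup_uniq u l l' :
  is_limn_sup u l -> is_limn_sup u l' -> l = l'.
Proof.
wlog ll' : l l' / l < l' => [th ul ul'|[ub _] [_ lb']].
  by have [/th|/th|] := ltgtP l l'; [exact|move=> th'; rewrite th'|].
have e_gt0 : 0 < (l' - l) / 3 by lra.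
have [N ubN] := ub _ e_gt0; have [n Nn] := lb' _ N e_gt0.
by have := ubN _ Nn; lra.
Qed.

Lemma limn_supP u : bounded_fun u -> is_limn_sup u (limn_sup u).
Proof.
move=> u_bnd; rewrite limn_supE //.
have ub n : has_ubound (sdrop u n).
  exact/has_ubound_sdrop/bounded_fun_has_ubound.
have lb := bounded_fun_has_lbound_sups u_bnd.
split=> [e e_gt0|e N e_gt0].
  have [_ [N _ <-] lt_e] : exists2 x, range (sups u) x & x < inf (range (sups u)) + e.
    apply: inf_adherent => //; split; last exact: lb.
    by exists (sups u 0), 0%N.
  exists N => n Nn; apply: le_trans (ltW lt_e).
  by apply: ub_le_sup; [exact: ub | exists n].
have : inf (range (sups u)) - e < sups u N.
  by rewrite ltrBlDr ltr_pwDr //; apply: ge_inf => //; exists N.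
case/sup_gt; first by exists (u N), N => /=.
by move=> _ [n Nn <-] /ltW ?; exists n.
Qed.

Lemma is_limn_sup_eq u l : bounded_fun u -> is_limn_sup u l -> limn_sup u = l.
Proof. by move=> /limn_supP; exact: is_limn_sup_uniq. Qed.

Lemma bounded_dist_int (x : nat -> R) : bounded_fun (fun n => dist_int (x n)).
Proof.
exists 1; split; first exact: num_real.
move=> M M_gt1 n _ /=; rewrite ger0_norm ?dist_int_ge0 //.
by rewrite (le_trans (dist_int_le_half _)) //; lra.
Qed.

Lemma limsup_spectrumP (a l : R) :
  limsup_spectrum a l <->
  exists xi, is_limn_sup (fun n => dist_int (xi * a ^+ n)) l.
Proof.
split=> [[xi _ <-]|[xi xil]]; exists xi => //.
  exact/limn_supP/bounded_dist_int.
by apply: is_limn_sup_eq => //; exact: bounded_dist_int.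
Qed.

Lemma limsup_spectrum_itv (a : R) :
  limsup_spectrum a `<=` [set x : R | 0 <= x <= 1 / 2].
Proof.
move=> l /limsup_spectrumP[xi [ub lb]] /=; apply/andP; split.
  apply/ler_addgt0Pr => e e_gt0; have [N ubN] := ub _ e_gt0.
  exact: le_trans (dist_int_ge0 _) (ubN _ (leqnn N)).
apply/ler_addgt0Pr => e e_gt0; have [n _] := lb _ 0%N e_gt0.
rewrite lerBlDr => /le_trans; apply; rewrite lerD2r; exact: dist_int_le_half.
Qed.

End LimnSup.

(** * Polynomials in the shift acting on sequences *)

Section ShiftPolynomial.

(** This is the [n]-th term of [p(S) x], where [S] is the shift. *)
Definition act (K : nzRingType) (p : {poly K}) (x : nat -> K) (n : nat) : K :=
  \sum_(i < size p) p`_i * x (n + i)%N.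

Lemma act_wide (K : nzRingType) (p : {poly K}) x n N :
  (size p <= N)%N -> act p x n = \sum_(i < N) p`_i * x (n + i)%N.
Proof.
move=> pN; rewrite /act (big_ord_widen _ (fun i => p`_i * x (n + i)%N) pN).
rewrite big_mkcond; apply: eq_bigr => i _.
by case: ltnP => // ip; rewrite nth_default ?mul0r.
Qed.

Lemma actC (K : nzRingType) (c : K) x n : act c%:P x n = c * x n.
Proof.
by rewrite (@act_wide _ _ _ _ 1) ?size_polyC_leq1 // big_ord1 coefC addn0.
Qed.

Lemma actZ (K : nzRingType) (c : K) p x n : act (c *: p) x n = c * act p x n.
Proof.
rewrite (@act_wide _ _ _ _ (size p)) ?size_scale_leq // mulr_sumr.
by apply: eq_bigr => i _; rewrite coefZ mulrA.
Qed.

Lemma actB (K : nzRingType) (p : {poly K}) x y n :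
  act p (fun i => x i - y i) n = act p x n - act p y n.
Proof. by rewrite /act -sumrB; apply: eq_bigr => i _; rewrite mulrBr. Qed.

Lemma act_XsubC_mul (K : comNzRingType) (c : K) (q : {poly K}) x n :
  act (('X - c%:P) * q) x n = act q x n.+1 - c * act q x n.
Proof.
have szX : (size (('X - c%:P) * q)%R <= (size q).+1)%N.
  by rewrite (leq_trans (size_polyMleq _ _)) // size_XsubC.
rewrite (act_wide _ _ szX) -(actZ c) (@act_wide _ (c *: q) _ _ (size q).+1).
  rewrite (eq_bigr (fun i : 'I_(size q).+1 =>
    ('X * q)`_i * x (n + i)%N - (c *: q)`_i * x (n + i)%N)).
    rewrite sumrB; congr (_ - _); rewrite big_ord_recl coefXM mul0r add0r.
    by apply: eq_bigr => i _; rewrite coefXM /= /bump /= add1n addnS addSn.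
  by move=> i _; rewrite mulrBl mul_polyC coefB mulrBl.
by rewrite (leq_trans (size_scale_leq _ _)).
Qed.

(** Geometric sequences of ratio [a] are eigenvectors of the shift for the eigenvalue [a]. *)
Lemma act_geom (K : comNzRingType) (p : {poly K}) c a n :
  act p (fun i => c * a ^+ i) n = c * p.[a] * a ^+ n.
Proof.
rewrite /act horner_coef mulr_sumr mulr_suml; apply: eq_bigr => i _.
by rewrite exprD; ring.
Qed.

Lemma act_map (K L : nzRingType) (f : {rmorphism K -> L}) (p : {poly K}) x n :
  act (map_poly f p) (f \o x) n = f (act p x n).
Proof.
rewrite (@act_wide _ _ _ _ (size p)) ?size_poly // /act rmorph_sum.
by apply: eq_bigr => i _; rewrite coef_map rmorphM.
Qed.

(** As the leading coefficient is 1, the equation at [n] determines term [n + d] from earlier ones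
    without division. With [K] the integers, the solution stays integral. *)
Lemma exists_act_eq (K : nzRingType) (p : {poly K}) (s : nat -> K) :
  p \is monic -> exists u : nat -> K, act p u =1 s.
Proof.
move=> p_monic; pose d := (size p).-1.
have szp : size p = d.+1 by rewrite prednK // size_poly_gt0 monic_neq0.
(* [us n] lists the first [n + d] terms of the solution whose [d] initial terms are 0. *)
pose us := fix us n := if n is n'.+1 then
  rcons (us n') (s n' - \sum_(i < d) p`_i * (us n')`_(n' + i)) else nseq d 0.
have size_us n : size (us n) = (n + d)%N.
  by elim: n => [|n IH] /=; rewrite ?size_nseq // size_rcons IH.
have us_le m k n : (n < m + d)%N -> (us (m + k)%N)`_n = (us m)`_n.
  move=> nm; elim: k => [|k IH]; first by rewrite addn0.
  rewrite addnS /= nth_rcons size_us ifT //.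
  by rewrite (leq_trans nm) // leq_add2r leq_addr.
pose u n := (us n.+1)`_n.
have usE m n : (n < m + d)%N -> (us m)`_n = u n.
  move=> nm; rewrite /u; have [mn|mn] := leqP m n.
    by rewrite -(subnKC (leqW mn)) us_le.
  by rewrite -{1}(subnKC mn) us_le // ltn_addr.
exists u => n; rewrite /act szp big_ord_recr /=.
have -> : p`_d = 1 by move/monicP: p_monic; rewrite /lead_coef.
rewrite mul1r -(usE n.+1) ?addSn // /= nth_rcons size_us ltnn eqxx.
rewrite [X in _ - X](eq_bigr (fun i : 'I_d => p`_i * u (n + i)%N)).
  by rewrite addrC subrK.
by move=> i _; rewrite usE // ltn_add2l.
Qed.

End ShiftPolynomial.

(** * Null sequences and linear recurrences *)

Section Vanishing.

(** Stated over any [numDomainType] so as to serve for both [R] and [R[i]]; in [R[i]], [0 < e]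
    forces [e] to be real. *)
Definition vanishes (K : numDomainType) (u : nat -> K) :=
  forall e : K, 0 < e -> exists N, forall n, (N <= n)%N -> `|u n| <= e.

(** A contraction with null perturbation. That the powers of [z] vanish is assumed because [K] may
    be non-archimedean. *)
Lemma vanishes_rec (K : numFieldType) (z : K) (u : nat -> K) :
  `|z| < 1 -> vanishes (fun n => z ^+ n) ->
  vanishes (fun n => u n.+1 - z * u n) -> vanishes u.
Proof.
move=> z_lt1 z_van r_van e e_gt0.
have e2_gt0 : 0 < e / 2 by rewrite divr_gt0.
(* With this bound on the perturbation, [e / 2] is the fixed point of the map
   [t -> |z| t + e / 2 * (1 - |z|)]. *)
have d_gt0 : 0 < e / 2 * (1 - `|z|) by rewrite mulr_gt0 // subr_gt0.
have [N rN] := r_van _ d_gt0.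
have uN k : `|u (N + k)%N| <= `|z| ^+ k * `|u N| + e / 2.
  elim: k => [|k IH]; first by rewrite addn0 expr0 mul1r lerDl ltW.
  rewrite addnS -(subrK (z * u (N + k)%N) (u _)).
  rewrite (le_trans (ler_normD _ _)) //.
  apply: le_trans (lerD (rN _ (leq_addr _ _)) (lexx _)) _.
  rewrite normrM; apply: le_trans (lerD (lexx _) (ler_wpM2l (normr_ge0 _) IH)) _.
  by rewrite le_eqVlt; apply/orP; left; apply/eqP; rewrite exprS; ring.
have c_gt0 : 0 < `|u N| + 1 by rewrite ltr_wpDl.
have [M zM] := z_van _ (divr_gt0 e2_gt0 c_gt0).
exists (N + M)%N => n NMn.
have Nn : (N <= n)%N by rewrite (leq_trans _ NMn) // leq_addr.
rewrite -(subnKC Nn) (le_trans (uN _)) // [leRHS]splitr lerD2r.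
have : `|z ^+ (n - N)| <= e / 2 / (`|u N| + 1) by apply: zM; rewrite leq_subRL.
rewrite normrX => /(ler_wpM2r (normr_ge0 (u N)))/le_trans; apply.
rewrite -mulrA ler_piMr ?(ltW e2_gt0) // mulrC ler_pdivrMr // mul1r.
by rewrite lerDl.
Qed.

(** Split [q] into linear factors and remove them one at a time by [vanishes_rec]. *)
Lemma vanishes_act (K : numClosedFieldType) (q : {poly K}) (v : nat -> K) :
    (forall z, root q z -> `|z| < 1 /\ vanishes (fun n => z ^+ n)) ->
  q != 0 -> vanishes (act q v) -> vanishes v.
Proof.
move=> rt q_neq0; have [rs qE] := closed_field_poly_normal q.
have lq : lead_coef q != 0 by rewrite lead_coef_eq0.
have {}rt z : z \in rs -> `|z| < 1 /\ vanishes (fun n => z ^+ n).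
  by move=> zrs; apply: rt; rewrite qE rootZ // root_prod_XsubC.
move=> qv.
have : vanishes (act (\prod_(z <- rs) ('X - z%:P)) v).
  move=> e e_gt0; have [|N hN] := qv (`|lead_coef q| * e).
    by rewrite mulr_gt0 // normr_gt0.
  exists N => n /hN; rewrite {1}qE actZ normrM ler_pM2l //.
  by rewrite normr_gt0.
elim: {qE} rs rt => [|z rs IH] rt.
  rewrite big_nil => v0 e /v0[N vN]; exists N => n /vN.
  by rewrite actC mul1r.
rewrite big_cons => v0; apply: IH => [y yrs|].
  by apply: rt; rewrite in_cons yrs orbT.
have [z1 zv] := rt z (mem_head _ _); apply: (@vanishes_rec _ z) => // e /v0[N vN].
by exists N => n /vN; rewrite act_XsubC_mul.
Qed.

Context {R : realType}.

Lemma vanishesP (u : nat -> R) : vanishes u <-> u @ \oo --> 0.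
Proof.
split=> [u0|/cvgrPdist_le u0 e e_gt0]; last first.
  have [N _ uN] := u0 _ e_gt0; exists N => n /uN /=.
  by rewrite sub0r normrN.
apply/cvgrPdist_le => e /u0[N uN]; exists N => // n /= /uN.
by rewrite sub0r normrN.
Qed.

Lemma vanishes_complexP (u : nat -> R) :
  vanishes (fun n => real_complex R (u n)) <-> vanishes u.
Proof.
split=> u0 e e_gt0.
  have [|N uN] := u0 (real_complex R e); first by rewrite ltcR.
  by exists N => n /uN; rewrite normc_def /= expr0n addr0 sqrtr_sqr lecR.
have : 0 < complex.Re e by move: e_gt0; case: (e) => a b; rewrite ltcE => /andP[].
move=> /u0[N uN]; exists N => n /uN un.
have -> : e = real_complex R (complex.Re e).
  by move: e_gt0; case: (e) => a b; rewrite ltcE /= => /andP[/eqP ->].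
by rewrite normc_def /= expr0n addr0 sqrtr_sqr lecR.
Qed.

Lemma vanishes_complex_geom (z : R[i]) : `|z| < 1 -> vanishes (fun n => z ^+ n).
Proof.
move=> z_lt1; pose r := complex.Re `|z|.
have zr : `|z| = real_complex R r by rewrite /r normc_def.
have r_ge0 : 0 <= r by rewrite -lecR -zr normr_ge0.
have r_lt1 : r < 1 by rewrite -ltcR -zr.
have : vanishes (fun n => r ^+ n).
  by apply/vanishesP/cvg_expr; rewrite ger0_norm.
move=> /vanishes_complexP r0 e /r0[N rN]; exists N => n /rN.
by rewrite normrX zr rmorphXn normrX /= -zr normr_id.
Qed.

Lemma vanishes_real_act (q : {poly R}) (v : nat -> R) :
    (forall z, root (map_poly (real_complex R) q) z -> `|z| < 1) ->
  q != 0 -> vanishes (act q v) -> vanishes v.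
Proof.
move=> rt q_neq0 qv; apply/vanishes_complexP.
apply: (@vanishes_act _ (map_poly (real_complex R) q)) => [z /rt z1||].
- by split=> //; exact: vanishes_complex_geom.
- by rewrite map_poly_eq0.
- move/vanishes_complexP : qv => qv e /qv[N vN]; exists N => n /vN.
  by rewrite (act_map (real_complex R)).
Qed.

(** The quotients [w n / a ^+ n] converge, and their distance to the limit [c] is [o(a ^- n)];
    multiplying back by [a ^+ n] leaves a null error. *)
Lemma vanishes_expanding (a : R) (w : nat -> R) : 1 < a ->
    vanishes (fun n => w n.+1 - a * w n) ->
  exists c, vanishes (fun n => w n - c * a ^+ n).
Proof.
move=> a_gt1 r_van; have a_gt0 : 0 < a by lra.
have a1_gt0 : 0 < a - 1 by lra.
pose y n := w n / a ^+ n.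
have an_gt0 n : 0 < a ^+ n by rewrite exprn_gt0.
have tail (e : R) : 0 < e -> exists N, forall n m, (N <= n)%N ->
    `|y (n + m)%N - y n| <= e / a ^+ n.
  move=> e_gt0; have [|N rN] := r_van (e * (a - 1)); first by rewrite mulr_gt0.
  exists N => n m Nn.
  (* One increment of [y] is at most [e * (a - 1) / a ^+ (n + m).+1], which is [e] times a
     difference of consecutive inverse powers, so the bounds telescope. *)
  have : `|y (n + m)%N - y n| <= e * (a ^- n - a ^- (n + m)).
    elim: m => [|m IH]; first by rewrite addn0 !subrr normr0 mulr0.
    rewrite -(subrK (y (n + m)%N) (y (n + m.+1)%N)) -addrA.
    apply: le_trans (ler_normD _ _) _.
    apply: le_trans (lerD (lexx _) IH) _; rewrite -lerBrDr.
    have -> : y (n + m.+1)%N - y (n + m)%N =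
        (w (n + m).+1 - a * w (n + m)%N) / a ^+ (n + m).+1.
      rewrite /y addnS mulrBl; congr (_ - _).
      by rewrite exprS -mulf_div divff ?mul1r // gt_eqF.
    rewrite normrM normfV (gtr0_norm (an_gt0 _)).
    apply: le_trans (ler_wpM2r _ (rN _ _)) _.
    - by rewrite invr_ge0 ltW.
    - by rewrite (leq_trans Nn) // leq_addr.
    - rewrite addnS exprS le_eqVlt; apply/orP; left; apply/eqP.
      move: (an_gt0 n) (an_gt0 (n + m)%N); set A := a ^+ n; set B := a ^+ (n + m).
      by move=> A0 B0; field; rewrite !gt_eqF.
  move=> /le_trans; apply; rewrite ler_pM2l // lerBlDr lerDl.
  by rewrite invr_ge0 ltW.
have /cauchy_cvgP/cvg_ex[c yc] : cauchy (y @ \oo).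
  apply: cauchy_exP => e e_gt0; have [|N yN] := tail (e / 2); first by lra.
  exists (y N); exists N => // n /= Nn; rewrite /ball /=.
  rewrite -(subnKC Nn) distrC (le_lt_trans (yN _ _ (leqnn N))) //.
  have aN : (a ^+ N)^-1 <= 1 by rewrite invf_le1 // exprn_ege1 // ltW.
  have := ler_wpM2l (ltW e_gt0) aN.
  by rewrite mulr1 mulrAC; lra.
exists c => e e_gt0; have [N yN] := tail _ e_gt0; exists N => n /yN {}yN.
have : `|c - y n| <= e / a ^+ n.
  apply/ler_addgt0Pr => d d_gt0.
  have /cvgrPdist_le/(_ _ d_gt0)[M _ yM] := yc.
  have /= cy := yM (n + M)%N (leq_addl _ _).
  rewrite [leRHS]addrC -(subrK (y (n + M)%N) c) -addrA.
  by rewrite (le_trans (ler_normD _ _)) // lerD.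
rewrite ler_pdivlMr // -{1}(gtr0_norm (an_gt0 n)) -normrM mulrBl distrC.
by rewrite /y divfK // gt_eqF.
Qed.

End Vanishing.

(** * Shadowing of approximate orbits modulo 1 *)

Lemma pisot_shadowing (R : realType) (a : R) (P : {poly int}) (Q : {poly R}) :
    1 < a -> P \is monic -> map_poly intr P = ('X - a%:P) * Q -> ~~ root Q a ->
    (forall z : R[i], root (map_poly (real_complex R) Q) z -> `|z| < 1) ->
  forall e : nat -> R,
    vanishes (fun n => dist_int (act (map_poly intr P) e n)) ->
  exists xi, vanishes (fun n => dist_int (xi * a ^+ n - e n)).
Proof.
move=> a_gt1 P_monic PE Qa Q_roots e Pe.
have Qa0 : Q.[a] != 0 by rewrite -rootE.
have Q_neq0 : Q != 0 by apply: contraNneq Qa => ->; rewrite root0.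
have /choice[s sE] : forall n, exists m,
    dist_int (act (map_poly intr P) e n) = `|act (map_poly intr P) e n - m%:~R|.
  by move=> n; have [m ? _] := dist_int_attained (act (map_poly intr P) e n); exists m.
(* Subtracting the integer sequence [u] leaves [e] unchanged modulo 1 and turns smallness of
   [P(S) e] modulo 1 into genuine smallness. *)
have [u uE] := exists_act_eq s P_monic.
pose x n := e n - (u n)%:~R.
have Px n : `|act Q x n.+1 - a * act Q x n| = dist_int (act (map_poly intr P) e n).
  rewrite -act_XsubC_mul -PE actB sE; congr `|_ - _|.
  by rewrite (act_map (intr : {rmorphism int -> R})) uE.
have [c cE] : exists c, vanishes (fun n => act Q x n - c * a ^+ n).
  apply: vanishes_expanding => // d /Pe[N PN]; exists N => n /PN.
  by rewrite Px ger0_norm ?dist_int_ge0.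
(* [Q(S)] multiplies [a ^+ n] by [Q.[a]], so this coefficient cancels the part [c * a ^+ n] of
   [Q(S) x]. *)
exists (c / Q.[a]); pose v n := x n - c / Q.[a] * a ^+ n.
have /(vanishes_real_act Q_roots Q_neq0) v0 : vanishes (act Q v).
  by move=> d /cE[N cN]; exists N => n /cN; rewrite (actB Q x) act_geom divfK.
move=> d /v0[N vN]; exists N => n /vN; apply: le_trans.
rewrite ger0_norm ?dist_int_ge0 // -(normrN (v n)).
apply: le_trans (dist_int_le_norm _).
rewrite -(dist_intDz _ (u n)).
by rewrite le_eqVlt; apply/orP; left; apply/eqP; congr dist_int; rewrite /v /x; ring.
Qed.

(** * Recurrent windows by compactness of the circle *)

Section Recurrence.

(** Fractional parts lie in the compact segment [[0, 1]], and a cluster point along an ultrafilter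
    is a limit. *)
Lemma ultra_circle_cvg (R : realType) (T : Type) (F : set_system T) (f : T -> R) :
  UltraFilter F ->
  exists c, forall e, 0 < e -> \forall t \near F, dist_int (f t - c) <= e.
Proof.
move=> FU; pose g t := f t - (Num.floor (f t))%:~R.
have g01 t : 0 <= f t - (Num.floor (f t))%:~R <= 1.
  rewrite subr_ge0 floor_le_tmp /= lerBlDr addrC ltW //.
  by have := floorD1_gt (f t); rewrite rmorphD.
have Fg : F (g @^-1` `[0, 1]%classic).
  by apply: filterE => t; rewrite /= in_itv /=; exact: g01.
have [c [_ gc]] := @segment_compact R 0 1 (g t @[t --> F]) _ Fg.
exists c => e e_gt0.
have [Fe|Fe] := in_ultra_setVsetC [set t | `|g t - c| <= e] FU.
  apply: filterS Fe => t /=; apply: le_trans.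
  apply: le_trans (dist_int_le _ (Num.floor (f t))) _.
  by rewrite addrAC.
have [y [/= ]] := gc [set y | ~ `|y - c| <= e] _ Fe (nbhsx_ballx c e e_gt0).
by rewrite /ball /= distrC => + /ltW.
Qed.

(** Limits along one such ultrafilter replace repeated extraction of subsequences. *)
Lemma exists_ultra_oo : exists F : set_system nat,
  UltraFilter F /\ forall N, \forall n \near F, (N <= n)%N.
Proof.
have [F [FU ooF]] := ultraFilterLemma eventually_filter.
by exists F; split => // N; apply: ooF; exists N.
Qed.

(** The window [c] is an iterated limit modulo 1, first in the position [i] for each [xi k], then in
    [k]; it is thus the same for all precisions [e], which lets excursions of different orbits be
    joined. *)
Lemma limsup_spectrum_recurrence (R : realType) (a l : R) (d : nat) :
  closure (limsup_spectrum a) l ->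
  exists c : nat -> R, forall e, 0 < e -> exists xi p q, [/\ (p + d < q)%N,
    forall j, (j < d)%N -> dist_int (xi * a ^+ (p + j) - c j) <= e,
    forall j, (j < d)%N -> dist_int (xi * a ^+ (q + j) - c j) <= e,
    forall i, (p <= i)%N -> dist_int (xi * a ^+ i) <= l + e
    & exists2 i, (p <= i < q)%N & l - e <= dist_int (xi * a ^+ i)].
Proof.
move=> al.
have /choice[xi xiP] : forall k : nat, exists xi : R, exists2 l',
    `|l - l'| < k.+1%:R^-1 & is_limn_sup (fun n => dist_int (xi * a ^+ n)) l'.
  move=> k; have k_gt0 : 0 < (k.+1%:R^-1 : R) by rewrite invr_gt0 ltr0n.
  have [l' [/limsup_spectrumP[xi xil'] ll']] := al _ (nbhsx_ballx l _ k_gt0).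
  by exists xi, l'.
have [F [FU F_oo]] := exists_ultra_oo.
have /choice[c1 c1P] : forall k, exists c : nat -> R, forall j e, 0 < e ->
    \forall i \near F, dist_int (xi k * a ^+ (i + j) - c j) <= e.
  move=> k; have /choice[ck ckP] : forall j, exists c, forall e, 0 < e ->
      \forall i \near F, dist_int (xi k * a ^+ (i + j) - c) <= e.
    by move=> j; exact: ultra_circle_cvg.
  by exists ck.
have /choice[c cP] : forall j, exists c, forall e, 0 < e ->
    \forall k \near F, dist_int (c1 k j - c) <= e.
  by move=> j; exact: ultra_circle_cvg.
exists c => e e_gt0; have e2_gt0 : 0 < e / 2 by lra.
have F_c : \forall k \near F, forall j : 'I_d, dist_int (c1 k j - c j) <= e / 2.
  by apply: filter_forall => j; exact: cP.
have [K KP] : exists K, forall k, (K <= k)%N -> (k.+1%:R^-1 : R) < e / 2.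
  by have [K _ KP] := near_infty_natSinv_lt (PosNum e2_gt0); exists K.
have [k [ck Kk]] := filter_ex (filterI F_c (F_oo K)).
have [l' ll' [ub lb]] := xiP k.
have {KP ll'} ll' := lt_trans ll' (KP _ Kk).
move: ll'; rewrite ltr_norml => /andP[ll'1 ll'2].
have F_c1 : \forall i \near F, forall j : 'I_d,
    dist_int (xi k * a ^+ (i + j) - c1 k j) <= e / 2.
  by apply: filter_forall => j; exact: c1P.
have near_c i : (forall j : 'I_d, dist_int (xi k * a ^+ (i + j) - c1 k j) <= e / 2) ->
    forall j, (j < d)%N -> dist_int (xi k * a ^+ (i + j) - c j) <= e.
  move=> ic j jd; rewrite -(subrK (c1 k j) (xi k * _)) -addrA [leRHS]splitr.
  apply: le_trans (dist_intD _ _) _.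
  exact: lerD (ic (Ordinal jd)) (ck (Ordinal jd)).
(* Choose in turn [N] for the upper bound, a return time [p] after [N], a time [i] after [p] with a
   nearly maximal value, and a return time [q] beyond both [i] and [p + d]. *)
have [N Nub] := ub _ e2_gt0.
have [p [/near_c pc Np]] := filter_ex (filterI F_c1 (F_oo N)).
have [i pi li] := lb _ p e2_gt0.
have [q [/near_c qc iq]] := filter_ex (filterI F_c1 (F_oo (i + p + d).+1)).
exists (xi k), p, q; split => //.
- by move: iq; lia.
- move=> n pn; have := Nub n (leq_trans Np pn); lra.
- by exists i; [move: iq; lia | lra].
Qed.

End Recurrence.

(** * Concatenation of finite excursions *)

Section Glue.
Variables p q : nat -> nat.
Hypothesis pq : forall m, (p m < q m)%N.

Definition glue_step (s : nat * nat) : nat * nat :=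
  if (s.2.+1 < q s.1)%N then (s.1, s.2.+1) else (s.1.+1, p s.1.+1).

(* [glue n = (m, i)]: position [n] of the glued sequence carries the [i]-th
   entry of the [m]-th sequence, which is followed from index [p m] up to
   index [q m] excluded. *)
Definition glue (n : nat) : nat * nat := iter n glue_step (0, p 0)%N.

Lemma glueP n : (p (glue n).1 <= (glue n).2 < q (glue n).1)%N.
Proof.
elim: n => [|n /andP[IH _]]; first by rewrite /= leqnn pq.
rewrite /glue iterS -/(glue n) /glue_step.
by case: ifP => [lt|_] /=; rewrite ?leqnn ?pq // lt (leq_trans IH).
Qed.

Lemma glue_stay n j : ((glue n).2 + j < q (glue n).1)%N ->
  glue (n + j) = ((glue n).1, (glue n).2 + j)%N.
Proof.
elim: j => [|j IH] lt; first by rewrite !addn0 -surjective_pairing.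
rewrite addnS /glue iterS -/(glue _) IH ?(leq_trans _ lt) ?addnS //.
by rewrite /glue_step /= -addnS lt.
Qed.

(** The overshoot past [q m] becomes the offset past [p m.+1]; the bound on it rules out a second
    jump. *)
Lemma glue_jump n j : (q (glue n).1 <= (glue n).2 + j)%N ->
  let m := (glue n).1.+1 in let l := ((glue n).2 + j - q (glue n).1)%N in
  (p m + l < q m)%N -> glue (n + j) = (m, p m + l)%N.
Proof.
move=> qj /= lt; have /andP[_ iq] := glueP n.
(* After [k] steps the index is the last one before [q], so step [k.+1] is the jump. *)
set k := (q (glue n).1 - (glue n).2).-1.
have kS : glue (n + k.+1) = ((glue n).1.+1, p (glue n).1.+1).
  rewrite addnS /glue iterS -/(glue _) glue_stay; last by rewrite /k; lia.
  by rewrite /glue_step /= ifF //; apply/negbTE; rewrite /k; lia.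
have -> : (n + j = n + k.+1 + ((glue n).2 + j - q (glue n).1))%N by rewrite /k; lia.
by rewrite glue_stay kS.
Qed.

Lemma glue_reach_start m : exists n, glue n = (m, p m).
Proof.
elim: m => [|m [n nE]]; first by exists 0%N.
exists (n + (q m - p m))%N; have := pq m; have := pq m.+1 => lt' lt.
rewrite glue_jump nE /=; first by rewrite subnKC ?subnn ?addn0 // ltnW.
  by rewrite subnKC // ltnW.
by rewrite subnKC ?subnn ?addn0 // ltnW.
Qed.

Lemma glue_reach m i : (p m <= i < q m)%N -> exists n, glue n = (m, i).
Proof.
move=> /andP[pi iq]; have [n nE] := glue_reach_start m.
by exists (n + (i - p m))%N; rewrite glue_stay nE /= subnKC.
Qed.

(** At most one jump occurs per step; hence late excursions sit at late positions. *)
Lemma glue1_le n : ((glue n).1 <= n)%N.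
Proof.
elim: n => // n IH; rewrite /glue iterS -/(glue n) /glue_step.
by case: ifP => _ //=; rewrite leqW.
Qed.

Lemma glue1_nondecreasing n k : ((glue n).1 <= (glue (n + k)).1)%N.
Proof.
elim: k => [|k IH]; first by rewrite addn0.
rewrite addnS /glue iterS -/(glue _) /glue_step.
by case: ifP => _ //=; rewrite leqW.
Qed.

Lemma glue1_eventually m : exists N, forall n, (N <= n)%N -> (m <= (glue n).1)%N.
Proof.
have [N NE] := glue_reach_start m; exists N => n Nn.
by rewrite -(subnKC Nn); apply: leq_trans (glue1_nondecreasing _ _); rewrite NE.
Qed.

End Glue.

(** * Realizing a limit of upper limits *)

Lemma pisot_limsup_spectrum_closed (R : realType) (a : R) :
  pisot a -> closed (limsup_spectrum a).
Proof.
move=> a_pisot; have [a_gt1 _ _] := a_pisot.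
have [P [Q [P_monic PE Qa Q_roots]]] := pisot_poly a_pisot.
(* [d] is the degree plus one, the number of consecutive terms that [P(S)] involves. *)
set PR := map_poly intr P in PE; pose d := size PR.
move=> l /(@limsup_spectrum_recurrence R a l d)[c cP].
pose eps m : R := m.+1%:R^-1.
have eps_gt0 m : 0 < eps m by rewrite invr_gt0 ltr0n.
have eps_le m n : (m <= n)%N -> eps n <= eps m.
  by move=> mn; rewrite lef_pV2 ?posrE ?ltr0n // ler_nat ltnS.
have eps_small e : 0 < e -> exists m, eps m < e.
  move=> e_gt0; have [N _ NP] := near_infty_natSinv_lt (PosNum e_gt0).
  by exists N; apply: NP => /=.
have /choice[xi /choice[p /choice[q xpq]]] := fun m => cP _ (eps_gt0 m).
have pdq m : (p m + d < q m)%N by have [] := xpq m.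
have pq m : (p m < q m)%N by rewrite (leq_ltn_trans _ (pdq m)) // leq_addr.
pose x m i := xi m * a ^+ i.
pose e n := x (glue p q n).1 (glue p q n).2.
(* Over [d] terms, [e] follows the current orbit modulo 1 even across a jump: the old orbit after
   [q m] and the new one after [p m.+1] are both close to [c]. As [p m.+1 + d < q m.+1], at most one
   jump occurs. *)
have window n j : (j < d)%N ->
    dist_int (e (n + j)%N - x (glue p q n).1 ((glue p q n).2 + j)%N) <= 2 * eps (glue p q n).1.
  move=> jd; set m := (glue p q n).1; set i := (glue p q n).2.
  have em := eps_gt0 m; have /andP[_ iq] := glueP pq n.
  have [qij|ijq] := leqP (q m) (i + j)%N; last first.
    rewrite /e glue_stay //= subrr (le_trans (dist_int_le_norm _)) // normr0.
    by lra.
  pose k := (i + j - q m)%N.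
  have kd : (k < d)%N by move: iq; rewrite -/m -/i /k; lia.
  rewrite /e glue_jump //= -/m -/i -/k; last by have := pdq m.+1; lia.
  have [_ _ cq _ _] := xpq m; have [_ cp _ _ _] := xpq m.+1.
  have {}cp := le_trans (cp _ kd) (eps_le _ _ (leqnSn m)).
  have := cq _ kd; rewrite subnKC // -dist_intN opprB => {}cq.
  rewrite -(subrK (c k) (x m.+1 _)) -addrA mulrDl !mul1r.
  by apply: le_trans (dist_intD _ _) (lerD _ _).
have Px m i : \sum_(j < d) PR`_j * x m (i + j)%N = 0.
  have -> : \sum_(j < d) PR`_j * x m (i + j)%N = act PR (x m) i by [].
  by rewrite act_geom PE hornerM hornerXsubC subrr mul0r mulr0 mul0r.
pose C := \sum_(j < d) `|PR`_j|.
have C_ge0 : 0 <= C by apply: sumr_ge0.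
(* [P(S)] annihilates each orbit, so only the deviation bounded by [window] remains; integrality of
   the coefficients lets it be measured modulo 1. *)
have Pe n : dist_int (act PR e n) <= C * (2 * eps (glue p q n).1).
  have -> : act PR e n = \sum_(j < d) PR`_j *
      (e (n + j)%N - x (glue p q n).1 ((glue p q n).2 + j)%N).
    rewrite (eq_bigr (fun j : 'I_d => PR`_j * e (n + j)%N -
        PR`_j * x (glue p q n).1 ((glue p q n).2 + j)%N)).
      by rewrite sumrB Px subr0.
    by move=> j _; rewrite mulrBr.
  apply: le_trans (dist_int_sum _ _) _; rewrite mulr_suml; apply: ler_sum => j _.
  rewrite coef_map; apply: le_trans (dist_int_Mz _ _) _.
  by rewrite ler_wpM2l // window.
have [om omP] : exists om, vanishes (fun n => dist_int (om * a ^+ n - e n)).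
  apply: (pisot_shadowing a_gt1 P_monic PE Qa Q_roots) => t t_gt0.
  have [|m m_lt] := eps_small (t / (2 * C + 1)); first by rewrite divr_gt0 //; lra.
  have [N NP] := glue1_eventually pq m; exists N => n /NP mn.
  rewrite ger0_norm ?dist_int_ge0 // (le_trans (Pe n)) //.
  have := le_lt_trans (eps_le _ _ mn) m_lt; rewrite ltr_pdivlMr; last by lra.
  have := eps_gt0 (glue p q n).1; nra.
apply/limsup_spectrumP; exists om; split => [t t_gt0|t N t_gt0].
  have t2_gt0 : 0 < t / 2 by lra.
  have [m m_lt] := eps_small _ t2_gt0; have [N1 N1P] := omP _ t2_gt0.
  have [N2 N2P] := glue1_eventually pq m; exists (maxn N1 N2) => n.
  rewrite geq_max => /andP[/N1P + /N2P mn]; rewrite ger0_norm ?dist_int_ge0 //.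
  have /andP[pn _] := glueP pq n; have [_ _ _ ub _] := xpq (glue p q n).1.
  have := ub _ pn; rewrite -/(x _ _) -/(e n).
  have := le_lt_trans (eps_le _ _ mn) m_lt.
  have := dist_int_dist (om * a ^+ n) (e n); rewrite ler_norml => /andP[_].
  by lra.
have t2_gt0 : 0 < t / 2 by lra.
have [m m_lt] := eps_small _ t2_gt0; have [N1 N1P] := omP _ t2_gt0.
(* Excursion [M] is precise enough because [M >= m], and its positions [n >= M] lie beyond [N] and
   [N1]. *)
pose M := maxn m (maxn N N1).
have [_ _ _ _ [i piq li]] := xpq M.
have [n nE] := glue_reach pq piq.
have : (M <= n)%N by have := glue1_le p q n; rewrite nE.
rewrite !geq_max => /and3P[_ Nn /N1P]; rewrite ger0_norm ?dist_int_ge0 // => om_n.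
exists n => //; have en : e n = xi M * a ^+ i by rewrite /e nE.
have mM : (m <= M)%N by rewrite leq_maxl.
have := le_lt_trans (eps_le _ _ mM) m_lt.
have := dist_int_dist (om * a ^+ n) (e n); rewrite ler_norml => /andP[+ _].
by rewrite en in om_n *; lra.
Qed.

Unset Implicit Arguments.

Theorem theorem2p1 (R : realType) (alpha : R) (halpha : pisot alpha) :
  closed (limsup_spectrum alpha) /\
  limsup_spectrum alpha `<=` [set x : R | 0 <= x <= 1 / 2].
Proof.
by split; [exact: pisot_limsup_spectrum_closed | exact: limsup_spectrum_itv].
Qed.
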